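(* For the urn model $M$ with parameters $m,c$ and initial composition $(W_0,B_0)$ described in the context, the number $W_n$ of white balls after $n$ draws satisfies, for all $n\ge 0$, $$\mathbb{E}(W_n)=\frac{W_0}{T_0}(nmc+T_0),$$ and the variance $\mathbb{V}(W_n)=\mathbb{E}(W_n^2)-\mathbb{E}(W_n)^2$ is determined via the second moment $$\mathbb{E}(W_n^2)=\frac{\binom{n-1+\lambda_1}{n}\binom{n-1+\lambda_2}{n}}{\binom{n-1+\frac{T_0}{mc}}{n}\binom{n-1+\frac{T_0-1}{mc}}{n}}\left(W_0^2+\frac{W_0c^2m}{T_0}\sum_{\ell=0}^{n-1}\frac{\ell+\frac{T_0-m}{mc}}{\ell+\frac{T_0-1}{mc}}\cdot\frac{\binom{\ell+\frac{T_0}{mc}}{\ell+1}\binom{\ell+\frac{T_0-1}{mc}}{\ell+1}}{\binom{\ell+\lambda_1}{\ell+1}\binom{\ell+\lambda_2}{\ell+1}}\right),$$ where $$\lambda_{1,2}=\frac{-\frac12+mc+T_0\pm\frac12\sqrt{1+4mc(1+c)}}{mc}.$$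
   Context: Urn model $M$: let $m\ge 1$ and $c\ge 1$ be integers. An urn initially contains $W_0$ white and $B_0$ black balls, where $W_0,B_0$ are integers with $W_0>0$, $B_0>0$, and $T_0=W_0+B_0\ge m$. At each discrete time step $m$ balls are drawn uniformly at random without replacement from the urn. If $m-\ell$ white balls and $\ell$ black balls have been drawn ($0\le\ell\le m$), the drawn balls are returned to the urn together with $c(m-\ell)$ additional white balls and $c\ell$ additional black balls. $W_n$ and $B_n$ denote the numbers of white and black balls after $n$ draws; the total is $T_n=W_n+B_n=T_0+nmc$. Thus, given the first $n-1$ draws, the probability that the $n$-th sample has exactly $k$ white balls is $\binom{W_{n-1}}{k}\binom{T_{n-1}-W_{n-1}}{m-k}/\binom{T_{n-1}}{m}$, $0\le k\le m$, and then $W_n=W_{n-1}+kc$. For real $x$ and integer $k\ge 0$, $\binom{x}{k}=x(x-1)\cdots(x-k+1)/k!$. *)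

(* Defs.v *)
From HB Require Import structures.
From mathcomp Require Import all_boot all_order all_algebra.
From mathcomp Require Import all_classical all_reals all_analysis.

Set Implicit Arguments.
Unset Strict Implicit.
Unset Printing Implicit Defensive.

Import Order.TTheory GRing.Theory Num.Theory.

Local Open Scope classical_set_scope.
Local Open Scope ring_scope.

Definition gbinom (R : realType) (x : R) (k : nat) : R :=
  (\prod_(i < k) (x - i%:R)) / k`!%:R.

(* A sequence [x : nat -> nat] records the draws: [x n] is the number of white
   balls in the (n+1)-st sample, the other [m - x n] balls of it being black. *)
Fixpoint white (c W0 : nat) (x : nat -> nat) (n : nat) : nat :=
  if n is n'.+1 then (white c W0 x n' + c * x n')%N else W0.

Fixpoint black (m c B0 : nat) (x : nat -> nat) (n : nat) : nat :=
  if n is n'.+1 then (black m c B0 x n' + c * (m - x n'))%N else B0.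

(* Probability of exactly [k <= m] white balls in a uniform sample, without
   replacement, of [m] balls from [w] white and [b] black ones. *)
Definition hypergeometric (R : realType) (m w b k : nat) : R :=
  'C(w, k)%:R * 'C(b, m - k)%:R / 'C(w + b, m)%:R.

Section urn_process.
Context d (T : measurableType d) (R : realType) (P : probability T R).

Definition cond_prob (A B : set T) : R := fine (P (A `&` B)) / fine (P B).

Definition history (X : nat -> T -> nat) (x : nat -> nat) (n : nat) : set T :=
  [set t | forall i, (i < n)%N -> X i t = x i].

Definition urn_draws (m c W0 B0 : nat) (X : nat -> {RV P >-> nat}) : Prop :=
  (forall n t, (X n t <= m)%N) /\
  (forall (n k : nat) (x : nat -> nat), (k <= m)%N ->
    (0 < P (history X x n))%E ->
    cond_prob [set t | X n t = k] (history X x n) =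
    hypergeometric R m (white c W0 x n) (black m c B0 x n) k).

Definition num_white (c W0 : nat) (X : nat -> T -> nat) (n : nat) (t : T) : R :=
  (white c W0 (fun i => X i t) n)%:R.

End urn_process.

Section second_moment_parameters.
Context (R : realType) (m c T0 : nat).

Definition lambda1 : R :=
  (- (1 / 2) + m%:R * c%:R + T0%:R
   + 1 / 2 * Num.sqrt (1 + 4 * m%:R * c%:R * (1 + c%:R))) / (m%:R * c%:R).

Definition lambda2 : R :=
  (- (1 / 2) + m%:R * c%:R + T0%:R
   - 1 / 2 * Num.sqrt (1 + 4 * m%:R * c%:R * (1 + c%:R))) / (m%:R * c%:R).

End second_moment_parameters.

(* Main.v *)
(* Given the past, the number k of white balls in a sample is hypergeometric, so
   Vandermonde's identity gives its first two factorial moments. With T_n the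
   total number of balls this yields
     E W_(n+1)   = (1 + mc / T_n) E W_n,
     E W_(n+1)^2 = r_n E W_n^2 + c^2 m (T_n - m) / (T_n (T_n - 1)) E W_n,
   where T_n (T_n - 1) r_n = (T_n + mc)^2 - T_n - 2 mc - m c^2 is a quadratic in
   n that factors as (mc)^2 (n + lambda1) (n + lambda2). The first recurrence
   telescopes, the second is solved by variation of constants, and the products
   of the factors n + x are the binomials binom(n - 1 + x, n), up to n!. *)
Require Import Defs.
From HB Require Import structures.
From mathcomp Require Import all_boot all_order all_algebra.
From mathcomp Require Import all_classical all_reals all_analysis.
From mathcomp Require Import ring lra zify.

Set Implicit Arguments.
Unset Strict Implicit.
Unset Printing Implicit Defensive.

Import Order.TTheory GRing.Theory Num.Theory.

Local Open Scope classical_set_scope.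
Local Open Scope ring_scope.

(** * Factorial moments of the hypergeometric law *)

(** Induction on [j] from Vandermonde's identity: absorption, k C(w, k) = w C(w-1, k-1), peels one
    factor off the falling factorial. The product form avoids division in [nat]. *)
Lemma sum_ffact_bin (j m w b : nat) :
  (\sum_(k < m.+1) k ^_ j * ('C(w, k) * 'C(b, m - k)) * (w + b) ^_ j =
   w ^_ j * m ^_ j * 'C(w + b, m))%N.
Proof.
elim: j m w => [|j IH] m w.
  rewrite !ffactn0 !mul1n -binomial.Vandermonde.
  by apply: eq_bigr => k _; rewrite !ffactn0 mul1n muln1.
(* The term k = 0 vanishes; the rest, shifted by one, is the sum for m - 1 and w - 1. *)
rewrite big_ord_recl /= ffact0n mul0n add0n.
case: m => [|m]; first by rewrite big_ord0 ffact0n muln0.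
case: w => [|w].
  rewrite ffact0n !mul0n big1 // => k _.
  by rewrite bin0n /= !(muln0, mul0n).
rewrite addSn !ffactSS.
have E (k : 'I_m.+1) : true ->
   (lift ord0 k ^_ j.+1 * ('C(w.+1, lift ord0 k) * 'C(b, m.+1 - lift ord0 k)) *
   ((w + b).+1 * (w + b) ^_ j) =
   w.+1 * (w + b).+1 * (k ^_ j * ('C(w, k) * 'C(b, m - k)) * (w + b) ^_ j))%N.
  move=> _; rewrite /lift /= /bump /= add1n ffactSS subSS.
  have := mul_bin_diag w.+1 k; rewrite /= => H.
  transitivity (k.+1 * 'C(w.+1, k.+1) * (k ^_ j * 'C(b, m - k) *
    ((w + b).+1 * (w + b) ^_ j)))%N; first by ring.
  by rewrite -H; ring.
rewrite (eq_bigr _ E) -big_distrr /= IH.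
have := mul_bin_diag (w + b).+1 m; rewrite /= => H.
transitivity (w.+1 * w ^_ j * m ^_ j * ((w + b).+1 * 'C(w + b, m)))%N; first by ring.
by rewrite H; ring.
Qed.

Lemma hypergeometric_ffact_moment (R : realType) (j m w b : nat) :
  (m <= w + b)%N -> (j <= w + b)%N ->
  \sum_(k < m.+1) (k ^_ j)%:R * hypergeometric R m w b k =
  (w ^_ j)%:R * (m ^_ j)%:R / ((w + b) ^_ j)%:R.
Proof.
move=> mN jN.
have C0 : 'C(w + b, m)%:R != 0 :> R by rewrite pnatr_eq0 -lt0n bin_gt0.
have F0 : ((w + b) ^_ j)%:R != 0 :> R by rewrite pnatr_eq0 -lt0n ffact_gt0.
apply: (mulIf F0); apply: (mulIf C0).
rewrite divfK // -!natrM -sum_ffact_bin natr_sum !mulr_suml.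
apply: eq_bigr => k _; rewrite /hypergeometric !natrM; field.
by [].
Qed.

Lemma natr_ffact2 (R : realType) n : (n ^_ 2)%:R = n%:R * (n%:R - 1) :> R.
Proof.
by case: n => [|n]; rewrite ?mul0r // ffactnS ffactn1 /= natrM -natr1 addrK.
Qed.

Section hypergeometric_step.
Context (R : realType) (m c w b : nat).
Hypotheses (mN : (m <= w + b)%N).

Lemma hypergeometric_mean : (0 < w + b)%N ->
  \sum_(k < m.+1) (w + c * k)%:R * hypergeometric R m w b k =
  w%:R * (1 + m%:R * c%:R / (w + b)%:R).
Proof.
move=> N0.
have N0' : (w + b)%:R != 0 :> R by rewrite pnatr_eq0 -lt0n.
have S0 : \sum_(k < m.+1) hypergeometric R m w b k = 1.
  transitivity (\sum_(k < m.+1) (k ^_ 0)%:R * hypergeometric R m w b k).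
    by apply: eq_bigr => k _; rewrite mul1r.
  by rewrite hypergeometric_ffact_moment // !ffactn0 divr1 mulr1.
have S1 := @hypergeometric_ffact_moment R 1 m w b mN N0.
transitivity (\sum_(k < m.+1)
  (w%:R * hypergeometric R m w b k
   + c%:R * ((k ^_ 1)%:R * hypergeometric R m w b k))).
  by apply: eq_bigr => k _; rewrite ffactn1 natrD natrM; ring.
rewrite big_split -!mulr_sumr /= S0 S1 !ffactn1.
by move: ((w + b)%:R) N0' => N N0'; field.
Qed.

(** The result is sorted by powers of [w], with coefficients depending on the urn only through [N],
    so that they can leave an expectation once the total is known to be deterministic. *)
Lemma hypergeometric_second_moment : (1 < w + b)%N ->
  let N : R := (w + b)%:R in
  \sum_(k < m.+1) (w + c * k)%:R ^+ 2 * hypergeometric R m w b k =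
  w%:R ^+ 2 * (((N + m%:R * c%:R) ^+ 2 - N - 2 * (m%:R * c%:R) - m%:R * c%:R ^+ 2)
     / (N * (N - 1)))
  + w%:R * (c%:R ^+ 2 * m%:R * (N - m%:R) / (N * (N - 1))).
Proof.
move=> N1 N; have N0 := ltnW N1.
have N0' : N != 0 by rewrite pnatr_eq0 -lt0n.
have N1' : N - 1 != 0 by rewrite subr_eq0 pnatr_eq1 neq_ltn N1 orbT.
have S0 : \sum_(k < m.+1) hypergeometric R m w b k = 1.
  transitivity (\sum_(k < m.+1) (k ^_ 0)%:R * hypergeometric R m w b k).
    by apply: eq_bigr => k _; rewrite mul1r.
  by rewrite hypergeometric_ffact_moment // !ffactn0 divr1 mulr1.
have S1 := @hypergeometric_ffact_moment R 1 m w b mN N0.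
have S2 := @hypergeometric_ffact_moment R 2 m w b mN N1.
(* Writing k^2 = k + k (k - 1) leaves only factorial moments. *)
transitivity (\sum_(k < m.+1)
  (w%:R ^+ 2 * hypergeometric R m w b k
   + (2 * w%:R * c%:R + c%:R ^+ 2) * ((k ^_ 1)%:R * hypergeometric R m w b k)
   + c%:R ^+ 2 * ((k ^_ 2)%:R * hypergeometric R m w b k))).
  apply: eq_bigr => k _.
  by rewrite ffactn1 natr_ffact2 natrD natrM; ring.
rewrite !big_split -!mulr_sumr /= S0 S1 S2 !ffactn1 !natr_ffact2 -/N.
by clearbody N; field; rewrite N0' N1'.
Qed.

End hypergeometric_step.

(** * Urn contents along a fixed sequence of draws *)

Lemma eq_white c W0 x y n : (forall i, (i < n)%N -> x i = y i) ->
  white c W0 x n = white c W0 y n.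
Proof.
elim: n => //= n IH xy; rewrite xy // IH // => i lt_in.
by rewrite xy // ltnW.
Qed.

Lemma eq_black m c B0 x y n : (forall i, (i < n)%N -> x i = y i) ->
  black m c B0 x n = black m c B0 y n.
Proof.
elim: n => //= n IH xy; rewrite xy // IH // => i lt_in.
by rewrite xy // ltnW.
Qed.

(** Since x_i <= m, the truncated subtraction in [black] is exact, and every step adds m c balls
    whatever the colours drawn. *)
Lemma white_black m c W0 B0 x n : (forall i, (x i <= m)%N) ->
  (white c W0 x n + black m c B0 x n = W0 + B0 + n * (m * c))%N.
Proof.
by move=> x_le; elim: n => [|n IH] /=; [lia|have := x_le n; nia].
Qed.

(** * Generalized binomials as rising products *)

Section gbinom_rising.
Context (R : realType).
Implicit Types (x : R) (n : nat).

(** Reversing the order of the factors turns the falling product from n - 1 + x into the rising one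
    from x. *)
Lemma gbinom_rising x n :
  gbinom (n%:R - 1 + x) n = (\prod_(i < n) (x + i%:R)) / n`!%:R.
Proof.
rewrite /gbinom; congr (_ / _).
rewrite (reindex_inj rev_ord_inj) /=; apply: eq_bigr => i _.
by rewrite natrB // -addn1 natrD; ring.
Qed.

Lemma gbinom_risingS x n :
  gbinom (n%:R + x) n.+1 = gbinom (n%:R - 1 + x) n * ((x + n%:R) / n.+1%:R).
Proof.
rewrite (_ : n%:R + x = n.+1%:R - 1 + x); last by rewrite -natr1; ring.
rewrite !gbinom_rising big_ord_recr /= factS natrM invfM; ring.
Qed.

Lemma gbinom_rising_gt0 x n : 0 < x -> 0 < gbinom (n%:R - 1 + x) n.
Proof.
move=> x0; rewrite gbinom_rising divr_gt0 ?ltr0n ?fact_gt0 //.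
by apply: prodr_gt0 => i _; rewrite ltr_wpDr.
Qed.

End gbinom_rising.

(** * Expectations of functions of the first n draws *)

Section draws.
Context d (T : measurableType d) (R : realType) (P : probability T R).
Context (m : nat) (X : nat -> {RV P >-> nat}).

(** The possible values of the first n draws form a finite list, so expectations reduce to finite
    sums. *)
Definition samples n : seq (seq nat) :=
  iter n (fun S => [seq rcons s k | s <- S, k <- iota 0 m.+1]) [:: [::]].

Definition draws n t : seq nat := mkseq (fun i => X i t) n.

Lemma samples_uniq n : uniq (samples n).
Proof.
elim: n => // n IH; apply: allpairs_uniq => //; first exact: iota_uniq.
by move=> [s k] [s' k'] _ _ /= /rcons_inj.
Qed.

Lemma size_samples n s : s \in samples n -> size s = n.
Proof.
elim: n s => [|n IH] s; first by rewrite inE => /eqP ->.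
by case/allpairsP => -[s' k] [/= /IH s'n _ ->]; rewrite size_rcons s'n.
Qed.

Lemma drawsS n t : draws n.+1 t = rcons (draws n t) (X n t).
Proof. exact: mkseqS. Qed.

Lemma nth_draws n t i : (i < n)%N -> nth 0%N (draws n t) i = X i t.
Proof. exact: nth_mkseq. Qed.

(** The default 0 of [nth] is harmless: a history of length n only reads indices below n = size
    s. *)
Lemma historyP s n t : size s = n ->
  history X (nth 0%N s) n t <-> draws n t = s.
Proof.
move=> sn; split=> [H|<- i lt_in]; last by rewrite nth_draws.
apply: (@eq_from_nth _ 0%N); first by rewrite size_mkseq.
by move=> i; rewrite size_mkseq => lt_in; rewrite nth_draws // H.
Qed.

Lemma historyS x n :
  history X x n.+1 = [set t | X n t = x n] `&` history X x n.
Proof.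
apply/seteqP; split=> t /= H.
  by split=> [|i lt_in]; apply: H; rewrite // ltnS ltnW.
by case: H => Xn H i; rewrite ltnS leq_eqVlt => /predU1P[->//|]; exact: H.
Qed.

Lemma measurable_draw n k : measurable [set t | X n t = k].
Proof.
rewrite (_ : [set t | _] = X n @^-1` [set k]) //; exact: measurable_funPTI.
Qed.

Lemma measurable_history x n : measurable (history X x n).
Proof.
elim: n => [|n IH].
  by rewrite (_ : history X x 0 = setT) //; apply/seteqP.
by rewrite historyS; apply: measurableI => //; exact: measurable_draw.
Qed.

Lemma eq_history x y n : (forall i, (i < n)%N -> x i = y i) ->
  history X x n = history X y n.
Proof.
by move=> xy; apply/seteqP; split=> t /= H i lt_in; rewrite H // xy.
Qed.

Hypothesis X_le : forall n t, (X n t <= m)%N.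

Lemma draws_samples n t : draws n t \in samples n.
Proof.
elim: n => [|n IH]; first by rewrite inE.
rewrite drawsS; apply: allpairs_f => //.
by rewrite mem_iota /= add0n ltnS.
Qed.

(** Histories of length n partition the space: only s = draws n t contributes, and it occurs once
    because [samples n] is duplicate-free. *)
Lemma comp_draws_indic (G : seq nat -> R) n t :
  G (draws n t) =
  \sum_(s <- samples n) G s * \1_(history X (nth 0%N s) n) t.
Proof.
rewrite (big_rem _ (draws_samples n t)) /= big_seq big1 => [|s].
  rewrite addr0 indicE mem_set ?mulr1 //.
  by apply/historyP => //; rewrite size_mkseq.
rewrite mem_rem_uniq ?samples_uniq // inE => /andP[/eqP neq s_in].
rewrite indicE memNset ?mulr0 // => /(historyP t (size_samples s_in)) H.
exact: neq.
Qed.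

Lemma Lfun1_draws (G : seq nat -> R) n : (fun t => G (draws n t)) \in Lfun P 1.
Proof.
apply/Lfun1_integrable.
rewrite (_ : EFin \o _ = (fun t => \sum_(s <- samples n)
   (G s)%:E * (\1_(history X (nth 0%N s) n) t)%:E)%E); last first.
  apply/funext => t /=; rewrite comp_draws_indic -sumEFin.
  by apply: eq_bigr.
apply: integrable_sum => // s _; apply: integrableZl => //.
exact: integrable_indic (measurable_history _ _).
Qed.

Lemma expectation_draws (G : seq nat -> R) n :
  'E_P[fun t => G (draws n t)]%E =
  (\sum_(s <- samples n) G s * fine (P (history X (nth 0%N s) n)))%:E.
Proof.
rewrite unlock.
under eq_integral => t _ do rewrite comp_draws_indic -sumEFin.
have mH s : measurable (history X (nth 0%N s) n) by exact: measurable_history.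
have iI s : P.-integrable setT (fun t => (\1_(history X (nth 0%N s) n) t)%:E).
  exact: integrable_indic.
rewrite integral_sum //; last first.
  by move=> s; exact: (integrableZl measurableT (G s) (iI s)).
rewrite -sumEFin; apply: eq_bigr => s _.
transitivity (\int[P]_t ((G s)%:E * (\1_(history X (nth 0%N s) n) t)%:E))%E; first by [].
by rewrite integralZl // integral_indic // setIT EFinM fineK ?fin_num_measure.
Qed.

End draws.

(** * One-step recurrences for the moments *)

Section urn_moments.
Context d (T : measurableType d) (R : realType) (P : probability T R).
Context (m c W0 B0 : nat) (X : nat -> {RV P >-> nat}).
Hypothesis urn : urn_draws m c W0 B0 X.

Let X_le n t : (X n t <= m)%N.
Proof. by case: urn. Qed.

(** This is the tower property in elementary form: the probability of a history extended by k is
    that of the history times the conditional probability of k. *)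
Lemma expectation_drawsS (G : seq nat -> R) n :
  'E_P[fun t => G (draws X n.+1 t)]%E =
  'E_P[fun t => (\sum_(k < m.+1) G (rcons (draws X n t) k) *
    hypergeometric R m (white c W0 (nth 0%N (draws X n t)) n)
       (black m c B0 (nth 0%N (draws X n t)) n) k)%R]%E.
Proof.
rewrite (expectation_draws X_le).
rewrite (expectation_draws X_le (fun s => \sum_(k < m.+1) G (rcons s k) *
    hypergeometric R m (white c W0 (nth 0%N s) n) (black m c B0 (nth 0%N s) n) k)).
congr (_%:E); rewrite big_allpairs_dep /=.
rewrite big_seq [in RHS]big_seq; apply: eq_bigr => s s_in.
have sn := size_samples s_in.
rewrite -[0%N :: _]/(index_iota 0 m.+1) big_mkord mulr_suml.
apply: eq_bigr => k _; rewrite -mulrA; congr (_ * _).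
rewrite historyS nth_rcons sn ltnn eqxx.
rewrite (@eq_history _ _ _ _ _ _ (nth 0%N s)); last first.
  by move=> i lt_in; rewrite nth_rcons sn lt_in.
set H := history _ _ _.
(* [urn_draws] says nothing about null histories, on which both sides vanish. *)
have [PH0|PHn0] := eqVneq (P H) 0.
  rewrite PH0 /= mulr0 (_ : P _ = 0%E) //.
  apply/eqP; rewrite -measure_le0 -PH0; apply: le_measure; rewrite ?inE.
  - by apply: measurableI; [exact: measurable_draw|exact: measurable_history].
  - exact: measurable_history.
  - exact: subIsetr.
have PH : (0 < P H)%E by rewrite lt0e PHn0 measure_ge0.
have [_ /(_ n k (nth 0%N s) (ltn_ord k) PH) <-] := urn.
rewrite /cond_prob divfK // -eqe fineK //.
by apply: fin_num_measure; exact: measurable_history.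
Qed.

(** The count behind [num_white] before its cast to [R], so that any function [g] on [nat] can be
    applied to it. *)
Definition numw n t := white c W0 (fun i => X i t) n.

Lemma Lfun1_numw (g : nat -> R) n : (fun t => g (numw n t)) \in Lfun P 1.
Proof.
rewrite (_ : (fun t => _) =
    (fun t => g (white c W0 (nth 0%N (draws X n t)) n))).
  exact: (Lfun1_draws X_le (fun s => g (white c W0 (nth 0%N s) n))).
apply/funext => t; congr g; apply: eq_white => i lt_in.
by rewrite nth_draws.
Qed.

Lemma expectation_numwS (g : nat -> R) n :
  'E_P[fun t => g (numw n.+1 t)]%E =
  'E_P[fun t => (\sum_(k < m.+1) g (numw n t + c * k)%N *
    hypergeometric R m (numw n t) (black m c B0 (fun i => X i t) n) k)%R]%E.
Proof.
transitivity ('E_P[fun t => g (white c W0 (nth 0%N (draws X n.+1 t)) n.+1)]%E).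
  congr expectation; apply/funext => t; congr g; apply: eq_white => i lt_in.
  by rewrite nth_draws.
rewrite (expectation_drawsS (fun s => g (white c W0 (nth 0%N s) n.+1))).
congr expectation; apply/funext => t; apply: eq_bigr => k _ /=.
have sz : size (draws X n t) = n by rewrite size_mkseq.
rewrite nth_rcons sz ltnn eqxx.
rewrite (@eq_white _ _ _ (fun i => X i t)); last first.
  by move=> i lt_in; rewrite nth_rcons sz lt_in nth_draws.
rewrite (@eq_white _ _ (nth 0%N (draws X n t)) (fun i => X i t)); last first.
  by move=> i lt_in; rewrite nth_draws.
rewrite (@eq_black _ _ _ (nth 0%N (draws X n t)) (fun i => X i t)) //.
by move=> i lt_in; rewrite nth_draws.
Qed.

Hypothesis mT0 : (m <= W0 + B0)%N.
Hypothesis T0_gt1 : (1 < W0 + B0)%N.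

(** The total N is the same for every outcome, so the factor in the conditional mean is a
    constant. *)
Lemma expectation_numw_step n : let N : R := (W0 + B0 + n * (m * c))%:R in
  'E_P[fun t => (numw n.+1 t)%:R]%E =
  ((1 + m%:R * c%:R / N)%:E * 'E_P[fun t => (numw n t)%:R])%E.
Proof.
move=> N; rewrite (expectation_numwS (fun w => w%:R)) -expectationZl; last first.
  exact: (Lfun1_numw (fun w => w%:R)).
congr expectation; apply/funext => t /=.
have E := white_black c W0 B0 n (X_le^~ t).
by rewrite hypergeometric_mean /numw E //; lia.
Qed.

Lemma expectation_numw_sqr_step n : let N : R := (W0 + B0 + n * (m * c))%:R in
  'E_P[(fun t => (numw n.+1 t)%:R ^+ 2)%R]%E =
  ((((N + m%:R * c%:R) ^+ 2 - N - 2 * (m%:R * c%:R) - m%:R * c%:R ^+ 2)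
     / (N * (N - 1)))%:E * 'E_P[(fun t => (numw n t)%:R ^+ 2)%R]
   + (c%:R ^+ 2 * m%:R * (N - m%:R) / (N * (N - 1)))%:E *
       'E_P[fun t => (numw n t)%:R])%E.
Proof.
move=> N; have L1 : (fun t => (numw n t)%:R) \in Lfun P 1.
  exact: (Lfun1_numw (fun w => w%:R)).
have L2 : (fun t => (numw n t)%:R ^+ 2) \in Lfun P 1.
  exact: (Lfun1_numw (fun w => w%:R ^+ 2)).
rewrite (expectation_numwS (fun w => w%:R ^+ 2)) -!expectationZl //.
rewrite -expectationD; last 2 first.
- exact: (Lfun1_numw (fun w => w%:R ^+ 2 * _)).
- exact: (Lfun1_numw (fun w => w%:R * _)).
congr expectation; apply/funext => t /=.
have E := white_black c W0 B0 n (X_le^~ t).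
by rewrite hypergeometric_second_moment /numw E //; lia.
Qed.

End urn_moments.

(** * The quadratic with roots -lambda1 and -lambda2 *)

Section lambda.
Context (R : realType) (m c T0 : nat).
Hypotheses (m0 : (0 < m)%N) (c0 : (0 < c)%N).
Let mc : R := m%:R * c%:R.
Let sqr_disc : Num.sqrt (1 + 4 * m%:R * c%:R * (1 + c%:R)) ^+ 2 =
   1 + 4 * m%:R * c%:R * (1 + c%:R) :> R.
Proof. by rewrite sqr_sqrtr // addr_ge0 // !mulr_ge0 // addr_ge0. Qed.

(** The two factors are conjugate, so their product is a difference of squares in which the root
    enters only through its square. *)
Lemma lambda_quadratic (n : R) :
  mc ^+ 2 * ((lambda1 R m c T0 + n) * (lambda2 R m c T0 + n)) =
  (T0%:R + n * mc + mc) ^+ 2 - (T0%:R + n * mc) - 2 * mc - m%:R * c%:R ^+ 2.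
Proof.
have m0' : m%:R != 0 :> R by rewrite pnatr_eq0 -lt0n.
have c0' : c%:R != 0 :> R by rewrite pnatr_eq0 -lt0n.
rewrite /lambda1 /lambda2; move: sqr_disc; set s := Num.sqrt _ => s2.
transitivity ((- (1 / 2) + m%:R * c%:R + T0%:R + n * mc) ^+ 2 - s ^+ 2 / 4).
  by rewrite /mc; field; rewrite m0' c0'.
by rewrite s2 /mc; field.
Qed.

(** Positivity keeps the binomials in the denominators of the closed form nonzero. *)
Lemma lambda2_gt0 : (1 < T0)%N -> 0 < lambda2 R m c T0.
Proof.
move=> T0_gt1.
have m1 : 1 <= m%:R :> R by rewrite ler1n.
have c1 : 1 <= c%:R :> R by rewrite ler1n.
have T2 : 2 <= T0%:R :> R by rewrite ler_nat.
rewrite /lambda2 divr_gt0 ?mulr_gt0 ?ltr0n // subr_gt0.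
have s_ge0 : 0 <= 1 / 2 * Num.sqrt (1 + 4 * m%:R * c%:R * (1 + c%:R)) :> R.
  by rewrite mulr_ge0 ?sqrtr_ge0.
have p_ge0 : 0 <= - (1 / 2) + m%:R * c%:R + T0%:R :> R.
  by have : 0 <= m%:R * c%:R :> R by []; lra.
(* Squared, the claim is 1/4 + mc (1 + c) < (mc + T0 - 1/2)^2; it follows from c <= mc and T0 >=
   2. *)
rewrite -ltr_sqr //.
rewrite exprMn sqr_disc -(mulrA 4).
have : c%:R <= m%:R * c%:R :> R by rewrite ler_peMl.
have : 0 <= m%:R * c%:R :> R by [].
move: (m%:R * c%:R) => u u0 cu.
have uu : 0 <= u * (u - c%:R) by rewrite mulr_ge0 // subr_ge0.
have uT : 0 <= u * (T0%:R - 2) by rewrite mulr_ge0 // subr_ge0.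
have TT : 0 <= (T0%:R - 2) * T0%:R :> R by rewrite mulr_ge0 // subr_ge0.
nra.
Qed.

Lemma lambda1_gt0 : (1 < T0)%N -> 0 < lambda1 R m c T0.
Proof.
move=> T0_gt1; apply: lt_le_trans (lambda2_gt0 T0_gt1) _.
rewrite /lambda1 /lambda2 ler_pM2r ?invr_gt0 ?mulr_gt0 ?ltr0n //.
by have := sqrtr_ge0 (1 + 4 * m%:R * c%:R * (1 + c%:R) : R); lra.
Qed.

End lambda.

(** * Solving the recurrences *)

Unset Implicit Arguments.

Theorem theorem1 (d : measure_display) (T : measurableType d) (R : realType)
    (P : probability T R) (m c W0 B0 : nat) (X : nat -> {RV P >-> nat}) :
  (1 <= m)%N -> (1 <= c)%N -> (0 < W0)%N -> (0 < B0)%N ->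
  (m <= W0 + B0)%N ->
  urn_draws m c W0 B0 X ->
  let W : nat -> T -> R := num_white R c W0 X in
  let T0 : R := (W0 + B0)%:R in
  let mc : R := m%:R * c%:R in
  let l1 : R := lambda1 R m c (W0 + B0) in
  let l2 : R := lambda2 R m c (W0 + B0) in
  forall n : nat,
  [/\ 'E_P[W n]%E = (W0%:R / T0 * (n%:R * m%:R * c%:R + T0))%:E,
      'V_P[W n]%E = ('E_P[(fun t => W n t ^+ 2)%R] - 'E_P[W n] ^+ 2)%E &
      'E_P[(fun t => W n t ^+ 2)%R]%E =
        (gbinom (n%:R - 1 + l1) n * gbinom (n%:R - 1 + l2) n
         / (gbinom (n%:R - 1 + T0 / mc) n
            * gbinom (n%:R - 1 + (T0 - 1) / mc) n)
         * (W0%:R ^+ 2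
            + W0%:R * c%:R ^+ 2 * m%:R / T0
              * \sum_(l < n)
                  (l%:R + (T0 - m%:R) / mc) / (l%:R + (T0 - 1) / mc)
                  * (gbinom (l%:R + T0 / mc) l.+1
                     * gbinom (l%:R + (T0 - 1) / mc) l.+1
                     / (gbinom (l%:R + l1) l.+1
                        * gbinom (l%:R + l2) l.+1))))%:E].
Proof.
move=> m0 c0 W0_gt0 B0_gt0 mT0 urn W T0 mc l1 l2.
have T0_gt1 : (1 < W0 + B0)%N by lia.
have T0_2 : 2 <= T0 by rewrite ler_nat.
have mc0 : 0 < mc by rewrite mulr_gt0 ?ltr0n.
have mcN0 : mc != 0 by rewrite gt_eqF.
have T0N0 : T0 != 0 by rewrite gt_eqF //; lra.
have totalE n : (W0 + B0 + n * (m * c))%:R = T0 + n%:R * mc.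
  by rewrite natrD !natrM.
(* This keeps T_n and T_n - 1 nonzero for [field]. *)
have total_ge2 n : 2 <= T0 + n%:R * mc by rewrite ler_wpDr // mulr_ge0 // ltW.
have mean n : 'E_P[W n]%E = (W0%:R / T0 * (T0 + n%:R * mc))%:E.
  (* The factor 1 + mc / T_n equals T_(n+1) / T_n. *)
  elim: n => [|n IH].
    by rewrite mul0r addr0 divfK // -(expectation_cst P).
  have -> := expectation_numw_step urn mT0 T0_gt1 n.
  rewrite totalE IH -EFinM; congr (_%:E); rewrite -natr1 -/mc.
  have := total_ge2 n.
  clearbody T0 mc; move: (n%:R) => x ?; field.
  by rewrite T0N0 gt_eqF //; lra.
move=> n; split.
- by rewrite mean; congr (_ * _)%:E; rewrite /mc; ring.
- have L1 := Lfun1_numw urn (fun w => w%:R) n.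
  have L2 := Lfun1_numw urn (fun w => w%:R ^+ 2) n.
  (* The variance is the covariance of [W n] with itself; [L1] and [L2] supply integrability. *)
  exact: covarianceE.
elim: n => [|n IH].
  rewrite big_ord0 mulr0 addr0 /gbinom !big_ord0 fact0 !divr1 !mulr1 divr1 mul1r.
  by rewrite -(expectation_cst P).
have -> := expectation_numw_sqr_step urn mT0 T0_gt1 n.
rewrite totalE IH mean -!EFinM -EFinD; congr (_%:E).
rewrite -/mc.
have l1_gt0 : 0 < l1 by exact: lambda1_gt0.
have l2_gt0 : 0 < l2 by exact: lambda2_gt0.
have x_gt0 : 0 < T0 / mc by rewrite divr_gt0 //; lra.
have y_gt0 : 0 < (T0 - 1) / mc by rewrite divr_gt0 //; lra.
have Q := @lambda_quadratic R m c (W0 + B0) m0 c0 n%:R.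
rewrite -/mc -/T0 -/l1 -/l2 in Q.
(* Let A_n be the quotient of binomials before the bracket. By [Q], r_n = A_(n+1) / A_n; in the new
   summand l = n the factor A_(n+1) cancels, leaving the inhomogeneous term c^2 m (T_n - m) / (T_n
   (T_n - 1)) E W_n. *)
rewrite -Q big_ord_recr /=.
set S := \sum_(l < n) _.
(* The outer binomials now have the shape of those in the summand l = n, so [gbinom_risingS]
   rewrites both. *)
rewrite (_ : n.+1%:R - 1 = n%:R); last by rewrite -natr1 addrK.
rewrite !gbinom_risingS.
(* With the four binomials abstracted to positive reals, a rational identity remains. *)
have := gbinom_rising_gt0 n l1_gt0; move: (gbinom _ _) => a a_gt0.
have := gbinom_rising_gt0 n l2_gt0; move: (gbinom _ _) => b b_gt0.
have := gbinom_rising_gt0 n x_gt0; move: (gbinom _ _) => p p_gt0.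
have := gbinom_rising_gt0 n y_gt0; move: (gbinom _ _) => q q_gt0.
have n1 : n.+1%:R != 0 :> R by rewrite pnatr_eq0.
have := total_ge2 n; move: (n.+1%:R) n1 (n%:R) (ler0n R n) => n1 n1_neq0 x x_ge0 tot.
clearbody l1 l2 T0 mc; field.
by rewrite n1_neq0 mcN0 T0N0 !gt_eqF //; lra.
Qed.
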